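(* Let $a_1,a_2,b_1\in\mathbb{C}$. For \[ \chi_2(\lambda,w)=(\lambda+a_1)(\lambda+a_2)-b_1^2w^2 \] the spectral curve $\chi_2(\lambda,w)=0$ is reducible (that is, $\chi_2$ is reducible in $\mathbb{C}[\lambda,w]$) if and only if either $b_1=0$ or $a_1=a_2$. *)

(* Defs.v *)
From HB Require Import structures.
From mathcomp Require Import all_boot all_order all_algebra.
From mathcomp Require Import reals complex mpoly.

Set Implicit Arguments.
Unset Strict Implicit.
Unset Printing Implicit Defensive.

Import GRing.Theory.
Local Open Scope ring_scope.

Definition reducible (A : idomainType) (f : A) : Prop :=
  [/\ f != 0, f \isn't a GRing.unit &
      exists p q : A,
        [/\ p \isn't a GRing.unit, q \isn't a GRing.unit & f = p * q]].

(* In C[lambda, w], lambda is the variable of index 0 and w that of index 1. *)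
Definition chi2 (C : idomainType) (a1 a2 b1 : C) : {mpoly C[2]} :=
  let lambda : {mpoly C[2]} := 'X_(ord0) in
  let w : {mpoly C[2]} := 'X_(ord_max) in
  (lambda + a1%:MP) * (lambda + a2%:MP) - (b1 ^+ 2)%:MP * w ^+ 2.

(* Main.v *)
Require Import Defs.
From mathcomp Require Import all_boot all_order all_algebra.
From mathcomp Require Import reals complex mpoly.
From mathcomp Require Import ring.

(** Both sides of the equivalence say that b1 (a1 - a2) = 0.

    If b1 (a1 - a2) = 0, then the cross terms cancel in
    (lambda + a1 - b1 w) (lambda + a2 + b1 w), and this product is chi2.

    Conversely, chi2 has total degree at most 2, so in a factorization into
    two non-units over a field, which both have degree at least 1
    ([nonunit_msize_gt1]), both factors have degree 1 ([chi2_factor_affine]).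
    Let alpha, beta, gamma and alpha', beta', gamma' be the coefficients of
    lambda, w, 1 in the two factors. Comparing the six coefficients of the product with those of chi2 gives
    alpha alpha' = 1, alpha beta' + beta alpha' = 0, beta beta' = - b1^2,
    alpha gamma' + gamma alpha' = a1 + a2, beta gamma' + gamma beta' = 0 and
    gamma gamma' = a1 a2. Eliminating the six unknowns from these equations
    yields (b1 (a1 - a2))^2 = 0 ([affine_factor_elimination]). The argument
    works over every field: it uses neither algebraic closedness nor the
    characteristic. *)

Set Implicit Arguments.
Unset Strict Implicit.
Unset Printing Implicit Defensive.

Import GRing.Theory.
Local Open Scope ring_scope.

Lemma mnm2_eqE (m1 m2 : 'X_{1..2}) :
  (m1 == m2) = (m1 ord0 == m2 ord0) && (m1 ord_max == m2 ord_max).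
Proof.
apply/eqP/andP => [->|[/eqP e0 /eqP e1]]; first by rewrite !eqxx.
apply/mnmP => -[[|[|//]] lt2].
- by have -> : Ordinal lt2 = ord0 by apply/val_inj.
- by have -> : Ordinal lt2 = ord_max by apply/val_inj.
Qed.

(** Two quadratic polynomials in two variables written in expanded form are
    equal only if their six coefficients agree. *)
Lemma quadratic2_inj (R : comNzRingType) (a b c d e f a' b' c' d' e' f' : R) :
  let X : {mpoly R[2]} := 'X_(ord0) in
  let Y : {mpoly R[2]} := 'X_(ord_max) in
  let Q a b c d e f : {mpoly R[2]} :=
    a%:MP * X ^+ 2 + b%:MP * (X * Y) + c%:MP * Y ^+ 2
    + d%:MP * X + e%:MP * Y + f%:MP in
  Q a b c d e f = Q a' b' c' d' e' f' ->
  [/\ a = a', b = b' & c = c'] /\ [/\ d = d', e = e' & f = f'].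
Proof.
move=> X Y Q eqQ.
have coefQ i j a0 b0 c0 d0 e0 f0 :
    (Q a0 b0 c0 d0 e0 f0)@_(U_(ord0) *+ i + U_(ord_max) *+ j) =
    a0 * ((2 == i) && (0 == j))%N%:R + b0 * ((1 == i) && (1 == j))%N%:R
    + c0 * ((0 == i) && (2 == j))%N%:R + d0 * ((1 == i) && (0 == j))%N%:R
    + e0 * ((0 == i) && (1 == j))%N%:R + f0 * ((0 == i) && (0 == j))%N%:R.
  rewrite /Q /X /Y !mpolyXn -mpolyXD !mcoeffD !mcoeffCM !mcoeffX mcoeffC.
  by rewrite !mnm2_eqE !(mnmDE, mulmnE, mnm1E, mnm0E) /= !(muln0, mul1n, mul0n,
    addn0, add0n, muln1) ![(i == 0)%N]eq_sym ![(j == 0)%N]eq_sym.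
have eqc i j : (Q a b c d e f)@_(U_(ord0) *+ i + U_(ord_max) *+ j) =
    (Q a' b' c' d' e' f')@_(U_(ord0) *+ i + U_(ord_max) *+ j) by rewrite eqQ.
have simpl01 := (mulr1, mulr0, addr0, add0r).
split; split.
- by have := eqc 2%N 0%N; rewrite !coefQ /= !simpl01.
- by have := eqc 1%N 1%N; rewrite !coefQ /= !simpl01.
- by have := eqc 0%N 2%N; rewrite !coefQ /= !simpl01.
- by have := eqc 1%N 0%N; rewrite !coefQ /= !simpl01.
- by have := eqc 0%N 1%N; rewrite !coefQ /= !simpl01.
- by have := eqc 0%N 0%N; rewrite !coefQ /= !simpl01.
Qed.

Lemma mpoly_affineE n (R : nzRingType) (p : {mpoly R[n]}) :
  (msize p <= 2)%N -> p = (p@_0)%:MP + \sum_i (p@_U_(i))%:MP * 'X_i.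
Proof.
move=> sz; apply/mpolyP => m; rewrite mcoeffD mcoeffC raddf_sum /=.
under eq_bigr => i _ do rewrite mcoeffCM mcoeffX.
case: (ltnP (mdeg m) 2) => [|dm]; last first.
  have -> : p@_m = 0.
    by apply/eqP; rewrite mcoeff_eq0; apply/msize_mdeg_ge/(leq_trans sz).
  have /negPf -> : m != 0%MM.
    by apply: contraTneq dm => ->; rewrite mdeg0.
  rewrite mulr0 add0r big1 // => i _.
  have /negPf -> : U_(i)%MM != m.
    by apply: contraTneq dm => <-; rewrite mdeg1.
  by rewrite mulr0.
rewrite ltnS leq_eqVlt ltnS leqn0 mdeg_eq0 => /orP[/mdeg1P[i /eqP ->]|/eqP ->].
  rewrite mnm1_eq0 mulr0 add0r (bigD1 i) //= eqxx mulr1 big1 ?addr0 // => j ne.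
  by rewrite eq_mnm1 (negPf ne) mulr0.
rewrite eqxx mulr1 big1 ?addr0 // => i _.
by rewrite mnm1_eq0 mulr0.
Qed.

Lemma nonunit_msize_gt1 n (F : fieldType) (p : {mpoly F[n]}) :
  p != 0 -> p \isn't a GRing.unit -> (1 < msize p)%N.
Proof.
move=> nz_p; apply: contraNltn => /msize1_polyC def_p.
have nz_c : p@_0 != 0 by apply: contraNneq nz_p => c0; rewrite def_p c0 mpolyC0.
apply/unitrP; exists (p@_0)^-1%:MP.
by rewrite {2 3}def_p -!mpolyCM mulVf ?mulfV.
Qed.

Lemma mcoeff1_nonunit n (R : idomainType) (p : {mpoly R[n]}) i :
  p@_U_(i) != 0 -> p \isn't a GRing.unit.
Proof.
apply: contra => /andP[/eqP -> _].
by rewrite mcoeffC mnm1_eq0 mulr0.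
Qed.

Lemma msize_chi2 (R : idomainType) (a1 a2 b1 : R) :
  (msize (chi2 a1 a2 b1) <= 3)%N.
Proof.
have szC (c : R) : (msize (c%:MP : {mpoly R[2]}) <= 1)%N.
  by rewrite msizeC leq_b1.
have szXC (a : R) : (msize ('X_(ord0) + a%:MP : {mpoly R[2]}) <= 2)%N.
  apply: leq_trans (msizeD_le _ _) _.
  by rewrite geq_max msizeX mdeg1 leqnn (leq_trans (szC a)).
have szM (p q : {mpoly R[2]}) : (msize (p * q) <= (msize p + msize q).-1)%N.
  have [->|nz_p] := eqVneq p 0; first by rewrite mul0r mmeasure0.
  have [->|nz_q] := eqVneq q 0; first by rewrite mulr0 mmeasure0.
  by rewrite msizeM.
apply: leq_trans (msizeD_le _ _) _; rewrite geq_max msizeN; apply/andP; split.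
  apply: leq_trans (szM _ _) _; rewrite -subn1 leq_subLR.
  exact: leq_add (szXC _) (szXC _).
apply: leq_trans (szM _ _) _; rewrite -subn1 leq_subLR mpolyXn msizeX mdegMn.
by rewrite mdeg1; apply: leq_add.
Qed.

(** A size is a degree plus one: two sizes at least 2, whose sum is at most
    3 + 1, are both equal to 2. *)
Lemma chi2_factor_affine (F : fieldType) (a1 a2 b1 : F) (p q : {mpoly F[2]}) :
  chi2 a1 a2 b1 != 0 -> p \isn't a GRing.unit -> q \isn't a GRing.unit ->
  chi2 a1 a2 b1 = p * q -> (msize p <= 2)%N /\ (msize q <= 2)%N.
Proof.
move=> nz Up Uq def; have := msize_chi2 a1 a2 b1.
move: nz; rewrite def mulf_eq0 => /norP[nz_p nz_q].
have := nonunit_msize_gt1 nz_p Up; have := nonunit_msize_gt1 nz_q Uq.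
rewrite msizeM //; case: (msize p) => [|[|k]] //; case: (msize q) => [|[|l]] //.
rewrite !addSn !addnS /= !ltnS leqn0 addn_eq0.
by move=> _ _ /andP[/eqP-> /eqP->].
Qed.

(** The certificate that eliminates the coefficients of the two factors.
    Multiplying beta beta' = - b^2 by alpha alpha' = 1 gives
    (beta alpha')^2 = b^2, while a1 - a2 is, up to sign, the difference of
    alpha gamma' and gamma alpha'. The vanishing of the mixed coefficients makes
    the product of beta alpha' with that difference zero. *)
Lemma affine_factor_elimination (R : comNzRingType)
    (al be ga al' be' ga' a1 a2 b : R) :
  al * al' = 1 -> al * be' + be * al' = 0 -> be * be' = - b ^+ 2 ->
  al * ga' + ga * al' = a1 + a2 -> be * ga' + ga * be' = 0 ->
  ga * ga' = a1 * a2 -> (b * (a1 - a2)) ^+ 2 = 0.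
Proof.
move=> e1 e2 e3 e4 e5 e6.
have mixed0 : be * al' * (al * ga' - ga * al') = 0.
  have -> : be * al' * (al * ga' - ga * al') =
    al * al' * (be * ga' + ga * be') - ga * al' * (al * be' + be * al') by ring.
  by rewrite e2 e5 !mulr0 subr0.
have b2E : b ^+ 2 = (be * al') ^+ 2.
  have -> : (be * al') ^+ 2 =
    be * al' * (al * be' + be * al') - al * al' * (be * be') by ring.
  by rewrite e1 e2 e3 mulr0 mul1r sub0r opprK.
have d2E : (a1 - a2) ^+ 2 = (al * ga' - ga * al') ^+ 2.
  have -> : (al * ga' - ga * al') ^+ 2 =
    (al * ga' + ga * al') ^+ 2 - 4%:R * (al * al' * (ga * ga')) by ring.
  by rewrite e1 e4 e6; ring.
by rewrite exprMn b2E d2E -exprMn mixed0 expr0n.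
Qed.

Lemma reducible_chi2 (F : fieldType) (a1 a2 b1 : F) :
  reducible (chi2 a1 a2 b1) <-> b1 * (a1 - a2) = 0.
Proof.
split=> [[nz _ [p [q [Up Uq def]]]]|bd0].
  have [/mpoly_affineE defp /mpoly_affineE defq] :=
    chi2_factor_affine nz Up Uq def.
  move: def; rewrite defp defq !big_ord_recl !big_ord0 !addr0.
  have -> : lift ord0 ord0 = ord_max :> 'I_2 by apply/val_inj.
  set ga := p@_0; set al := p@_U_(ord0); set be := p@_U_(ord_max).
  set ga' := q@_0; set al' := q@_U_(ord0); set be' := q@_U_(ord_max).
  move=> def.
  have [] := @quadratic2_inj F (al * al') (al * be' + be * al') (be * be')
    (al * ga' + ga * al') (be * ga' + ga * be') (ga * ga')
    1 0 (- b1 ^+ 2) (a1 + a2) 0 (a1 * a2).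
    transitivity (chi2 a1 a2 b1).
      by rewrite def !(mpolyCD, mpolyCM); ring.
    by rewrite /chi2 !(mpolyCD, mpolyCM, mpolyCN, mpolyC0, mpolyC1); ring.
  move=> [e1 e2 e3] [e4 e5 e6].
  by apply/eqP; rewrite -sqrf_eq0 (affine_factor_elimination e1 e2 e3 e4 e5 e6).
pose p c b : {mpoly F[2]} := 'X_(ord0) + c%:MP + b%:MP * 'X_(ord_max).
have coefp c b : (p c b)@_U_(ord0) != 0.
  rewrite !mcoeffD mcoeffCM mcoeffC !mcoeffXU mnm1_eq0 /=.
  by rewrite !mulr0 !addr0 oner_neq0.
have Up c b := mcoeff1_nonunit (coefp c b).
have nz_p c b : p c b != 0.
  by apply: contraNneq (coefp c b) => ->; rewrite mcoeff0.
have def : chi2 a1 a2 b1 = p a1 (- b1) * p a2 b1.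
  have -> : p a1 (- b1) * p a2 b1 =
      chi2 a1 a2 b1 + (b1 * (a1 - a2))%:MP * 'X_(ord_max).
    by rewrite /p /chi2 !(mpolyCD, mpolyCM, mpolyCN, mpolyCB); ring.
  by rewrite bd0 mpolyC0 mul0r addr0.
split; first by rewrite def mulf_neq0.
  by rewrite def unitrM negb_and Up.
by exists (p a1 (- b1)), (p a2 b1).
Qed.

Theorem proposition4p1 (R : realType) (a1 a2 b1 : R[i]) :
  reducible (chi2 a1 a2 b1) <-> (b1 = 0%R \/ a1 = a2).
Proof.
rewrite reducible_chi2; split=> [/eqP|[->|->]]; last 2 first.
- by rewrite mul0r.
- by rewrite subrr mulr0.
by rewrite mulf_eq0 subr_eq0 => /orP[]/eqP; [left|right].
Qed.
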